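(* Let $q$ be a prime power and let $\mathcal{C}$ be an $[n,k]_q$ code with generator matrix $G\in\mathbb{F}_q^{k\times n}$. Let $1\leq t\leq k$ be an integer. Then \[ R_t(\mathcal{C})\geq \max_{\substack{U\in\mathbb{F}_q^{t\times k}\\ \operatorname{rank} U=t}}\ \sum_{\substack{\langle v\rangle\in\mathrm{PG}(k-1,q)\\ Uv\neq 0}}\left(\#_{\langle v\rangle}(P_G)-\left\lceil\frac{\#_{\langle v\rangle}(P_G)}{q^t}\right\rceil\right),\] and the right-hand side does not depend on the choice of the generator matrix $G$ of $\mathcal{C}$.
   Context: An $[n,k]_q$ code $\mathcal{C}$ is a $k$-dimensional $\mathbb{F}_q$-linear subspace of $\mathbb{F}_q^n$; a generator matrix for $\mathcal{C}$ is a matrix $G\in\mathbb{F}_q^{k\times n}$ whose row space is $\mathcal{C}$. For a matrix $V\in\mathbb{F}_q^{t\times n}$, $\operatorname{wt}(V)$ is the number of non-zero columns of $V$, and $d(V,V')=\operatorname{wt}(V-V')$. $\mathcal{C}^t$ is the set of matrices in $\mathbb{F}_q^{t\times n}$ all of whose rows are in $\mathcal{C}$. The $t$-th generalized covering radius is $R_t(\mathcal{C})=\max_{V\in\mathbb{F}_q^{t\times n}}\min_{C\in\mathcal{C}^t} d(V,C)$. $\mathrm{PG}(k-1,q)$ is the set of projective points $\langle v\rangle$, i.e. equivalence classes of vectors $v\in\mathbb{F}_q^k\setminus\{0\}$ up to multiplication by non-zero scalars of $\mathbb{F}_q$ (the condition $Uv\neq 0$ depends only on $\langle v\rangle$). $P_G$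 is the multiset of projective points $\langle G_{|j}\rangle$ over all $1\leq j\leq n$ for which the $j$-th column $G_{|j}$ of $G$ is non-zero, and $\#_{\langle v\rangle}(P_G)$ is the multiplicity of $\langle v\rangle$ in $P_G$ (possibly $0$). *)

(* Defs.v *)
From HB Require Import structures.
From mathcomp Require Import all_boot all_order all_algebra.

Set Implicit Arguments.
Unset Strict Implicit.
Unset Printing Implicit Defensive.

Import Order.TTheory GRing.Theory Num.Theory.

Local Open Scope ring_scope.

(* F is a finite field and q = #|F|.  Codewords are row vectors; a code of
   length n is a subspace of 'rV[F]_n, and its dimension is \dim C. *)

Definition generator_matrix (F : finFieldType) (n k : nat)
    (C : {vspace 'rV[F]_n}) (G : 'M[F]_(k, n)) : Prop :=
  forall x : 'rV[F]_n, (x \in C) = (x <= G)%MS.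

Definition wt (F : finFieldType) (t n : nat) (V : 'M[F]_(t, n)) : nat :=
  #|[set j : 'I_n | col j V != 0]|.

Definition dist (F : finFieldType) (t n : nat) (V W : 'M[F]_(t, n)) : nat :=
  wt (V - W).

Definition code_power (F : finFieldType) (n t : nat) (C : {vspace 'rV[F]_n}) :
    {set 'M[F]_(t, n)} :=
  [set V : 'M[F]_(t, n) | [forall i : 'I_t, row i V \in C]].

(* The zero matrix is always in code_power t C, so the arg min below is a
   genuine minimiser. *)
Definition dist_to_code (F : finFieldType) (n t : nat)
    (C : {vspace 'rV[F]_n}) (V : 'M[F]_(t, n)) : nat :=
  dist V [arg min_(W < (0%R : 'M[F]_(t, n)) in code_power t C) dist V W]%N.

Definition covering_radius (F : finFieldType) (n t : nat)
    (C : {vspace 'rV[F]_n}) : nat :=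
  (\max_(V : 'M[F]_(t, n)) dist_to_code C V)%N.

Definition proj_point (F : finFieldType) (k : nat) (v : 'cV[F]_k) :
    {set 'cV[F]_k} :=
  [set a *: v | a : F & a != 0].

(* PG F k is the projective space PG(k-1, q). *)
Definition PG (F : finFieldType) (k : nat) : {set {set 'cV[F]_k}} :=
  [set proj_point v | v : 'cV[F]_k & v != 0].

(* P_G, as a sequence considered up to reordering. *)
Definition column_points (F : finFieldType) (n k : nat) (G : 'M[F]_(k, n)) :
    seq {set 'cV[F]_k} :=
  [seq proj_point (col j G) | j <- enum 'I_n & col j G != 0].

Definition multiplicity (F : finFieldType) (n k : nat) (G : 'M[F]_(k, n))
    (p : {set 'cV[F]_k}) : nat :=
  count_mem p (column_points G).

Definition nonvanishing (F : finFieldType) (t k : nat) (U : 'M[F]_(t, k))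
    (p : {set 'cV[F]_k}) : bool :=
  [exists v in p, U *m v != 0].

Lemma nonvanishingE (F : finFieldType) (t k : nat) (U : 'M[F]_(t, k))
    (v : 'cV[F]_k) :
  nonvanishing U (proj_point v) = (U *m v != 0).
Proof.
apply/existsP/idP => [[w /andP[/imsetP[a a0 ->]]]|Uv].
  by rewrite -scalemxAr scaler_eq0 negb_or => /andP[].
exists v; rewrite Uv andbT; apply/imsetP; exists 1; rewrite ?scale1r //.
by rewrite inE oner_neq0.
Qed.

Definition ceil_div (m d : nat) : nat :=
  `|Num.ceil (m%:R / d%:R : rat)|%N.

(* The absolute value in ceil_div changes nothing, and by the second lemma
   neither does the truncation of the subtraction in lower_bound. *)
Lemma ceil_divE (m d : nat) :
  (ceil_div m d)%:Z = Num.ceil (m%:R / d%:R : rat).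
Proof.
rewrite /ceil_div gez0_abs // -(ceil0 rat).
by apply: le_ceil; rewrite divr_ge0 ?ler0n.
Qed.

Lemma ceil_div_le (m d : nat) : (ceil_div m d <= m)%N.
Proof.
rewrite -lez_nat ceil_divE ceil_le_int.
case: d => [|d]; first by rewrite invr0 mulr0 ler0n.
by rewrite ler_pdivrMr ?ltr0n // -natrM ler_nat leq_pmulr.
Qed.

Definition lower_bound (F : finFieldType) (n k t : nat) (G : 'M[F]_(k, n)) :
    nat :=
  (\max_(U : 'M[F]_(t, k) | \rank U == t)
     \sum_(p in PG F k | nonvanishing U p)
        (multiplicity G p - ceil_div (multiplicity G p) (#|F| ^ t)))%N.

(* Main.v *)
(* Elements of C^t are the W = M G.  Columns of G on a point <v> are scalar
   multiples a_j v, and W agrees with V in column j iff V_j / a_j = M v.  If on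
   each point the vectors V_j / a_j are spread evenly over the q^t elements of
   F_q^t, then every W agrees with V in at most ceil(m / q^t) of the m columns on
   that point.  This bounds R_t by the sum over all points of PG(k-1,q), which
   dominates the sum attached to any U.  Another generator matrix is A G with A
   invertible; A permutes the points and U |-> U A permutes the matrices U. *)
Require Import Defs.
From HB Require Import structures.
From mathcomp Require Import all_boot all_order all_algebra all_field.

Set Implicit Arguments.
Unset Strict Implicit.
Unset Printing Implicit Defensive.

Import Order.TTheory GRing.Theory Num.Theory.

Local Open Scope ring_scope.

Lemma leq_ceil_div_mul (m d : nat) : (0 < d)%N -> (m <= ceil_div m d * d)%N.
Proof.
move=> d_gt0; rewrite -(ler_nat rat) natrM -ler_pdivrMr ?ltr0n //.
by rewrite -[(ceil_div m d)%:R]/((ceil_div m d)%:Z%:~R) ceil_divE ceil_ge.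
Qed.

Lemma col_mul (R : pzRingType) (m n p : nat) (j : 'I_p) (A : 'M[R]_(m, n))
    (B : 'M[R]_(n, p)) : col j (A *m B) = A *m col j B.
Proof. by rewrite !colE mulmxA. Qed.

Lemma proj_point_id (F : finFieldType) (k : nat) (v : 'cV[F]_k) :
  v \in proj_point v.
Proof. by apply/imsetP; exists 1; rewrite ?scale1r // inE oner_neq0. Qed.

(** [r] depends only on the point, so all columns on one point are multiples of a single vector and
    can be compared through their scalars [a v]. *)
Lemma proj_point_representative (F : finFieldType) (k : nat) :
  exists (r : {set 'cV[F]_k} -> 'cV[F]_k) (a : 'cV[F]_k -> F),
    forall v, v != 0 -> a v != 0 /\ v = a v *: r (proj_point v).
Proof.
pose r (p : {set 'cV[F]_k}) := odflt 0 [pick w in p].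
exists r, (fun v => odflt 0 [pick a | v == a *: r (proj_point v)]) => v v0.
case: pickP => [a /eqP va|no_a] /=.
  by split=> //; apply: contraNneq v0 => a0; rewrite va a0 scale0r.
(* The default scalar is never reached: the representative is a nonzero multiple of [v], and
   inverting that factor gives a witness. *)
have : r (proj_point v) \in proj_point v.
  by rewrite /r; case: pickP => // /(_ v); rewrite proj_point_id.
case/imsetP=> a; rewrite inE => a0 ra.
by have /negP[] := negbT (no_a a^-1); rewrite ra scalerA mulVf // scale1r eqxx.
Qed.

(** Keeps the column indices that the multiset of points forgets, so that the columns on one point
    can be enumerated. *)
Definition point_columns (F : finFieldType) (n k : nat) (G : 'M[F]_(k, n))
    (p : {set 'cV[F]_k}) : {set 'I_n} :=
  [set j | (col j G != 0) && (proj_point (col j G) == p)].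

Lemma multiplicityE (F : finFieldType) (n k : nat) (G : 'M[F]_(k, n)) p :
  multiplicity G p = #|point_columns G p|.
Proof.
rewrite /multiplicity /column_points count_map count_filter.
rewrite cardE [in RHS]/enum_mem size_filter -enumT.
by apply: eq_count => j; rewrite /= !inE andbC.
Qed.

(** Distinct points have disjoint sets of columns; equality can fail because zero columns lie on no
    point. *)
Lemma leq_sum_point_columns (F : finFieldType) (n k : nat) (G : 'M[F]_(k, n))
    (D : {set 'I_n}) :
  (\sum_(p in PG F k) #|point_columns G p :&: D| <= #|D|)%N.
Proof.
rewrite -[leqRHS](cardsID [set j | col j G != 0]) -[leqLHS]addn0 leq_add //.
rewrite -sum1_card (partition_big (fun j => proj_point (col j G))
  (fun p => p \in PG F k)) => [|j] /=.
  apply: leq_sum => p _; rewrite -sum1_card; apply/eq_leq/eq_bigl => j.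
  by rewrite !inE andbC andbA.
by rewrite !inE => /andP[_ j0]; apply/imsetP; exists (col j G); rewrite ?inE.
Qed.

Lemma code_powerP (F : finFieldType) (n k t : nat) (C : {vspace 'rV[F]_n})
    (G : 'M[F]_(k, n)) (W : 'M[F]_(t, n)) :
  generator_matrix C G ->
  reflect (exists M : 'M[F]_(t, k), W = M *m G) (W \in code_power t C).
Proof.
move=> genG; rewrite inE; apply: (equivP forallP); split.
  by move=> WC; apply/submxP/row_subP => i; rewrite -genG.
by move=> /submxP/row_subP WG i; rewrite genG.
Qed.

Lemma dist_to_code_ge (F : finFieldType) (n t d : nat)
    (C : {vspace 'rV[F]_n}) (V : 'M[F]_(t, n)) :
  (forall W, W \in code_power t C -> (d <= dist V W)%N) ->
  (d <= dist_to_code C V)%N.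
Proof.
move=> le_d; rewrite /dist_to_code; case: arg_minnP => [|W WC _]; last exact: le_d.
by rewrite inE; apply/forallP => i; rewrite row0 mem0v.
Qed.

Lemma covering_radius_ge_sum_PG (F : finFieldType) (n k t : nat)
    (C : {vspace 'rV[F]_n}) (G : 'M[F]_(k, n)) :
  generator_matrix C G ->
  (\sum_(p in PG F k)
     (multiplicity G p - ceil_div (multiplicity G p) (#|F| ^ t))
   <= covering_radius t C)%N.
Proof.
move=> genG; have [r [a ra]] := proj_point_representative F k.
pose q := #|{: 'cV[F]_t}|.
have q_gt0 : (0 < q)%N by apply/card_gt0P; exists 0.
have qE : (#|F| ^ t)%N = q by rewrite /q card_mx muln1.
pose cl j := point_columns G (proj_point (col j G)).
(* The even spread: successive columns on a point run cyclically through the [q] vectors of length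
   [t]. *)
pose w j : 'cV[F]_t := enum_val (Ordinal (ltn_pmod (index j (enum (cl j))) q_gt0)).
pose V : 'M[F]_(t, n) := \matrix_(i, j) (a (col j G) *: w j) i 0.
have colV j : col j V = a (col j G) *: w j.
  by apply/matrixP => i l; rewrite !mxE ord1.
apply: leq_trans (leq_bigmax V); apply: dist_to_code_ge => W.
case/(code_powerP _ genG) => M ->; rewrite /dist /wt.
set D := [set j | _]; apply: leq_trans (leq_sum_point_columns G D).
(* Point by point, it remains to bound by the ceiling the number of columns outside [D], where [V]
   and [M *m G] agree. *)
apply: leq_sum => p _; rewrite multiplicityE qE leq_subLR addnC.
rewrite -[leqLHS](cardsID D) leq_add2l.
set m := #|point_columns G p|.
have agree j : j \in point_columns G p :\: D ->
  [/\ j \in point_columns G p, cl j = point_columns G p & w j = M *m r p].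
  rewrite !inE negbK => /andP[/eqP Dj /andP[j0 /eqP jp]].
  have [aj jE] := ra _ j0.
  split; [by rewrite j0 jp eqxx | by rewrite /cl jp |].
  (* Cancelling the nonzero scalar turns agreement in column [j] into an equation whose right-hand
     side no longer depends on [j]. *)
  apply: (scalerI aj); rewrite -colV -jp scalemxAr -jE.
  by move/eqP: Dj; rewrite linearB subr_eq0 /= => /eqP ->; rewrite col_mul.
(* Within a residue class mod q, an index is determined by its quotient. *)
pose f j : nat := (index j (enum (point_columns G p)) %/ q)%N.
have f_lt j : j \in point_columns G p :\: D -> (f j < ceil_div m q)%N.
  move=> /agree[jp _ _]; rewrite ltn_divLR //.
  apply: leq_trans (leq_ceil_div_mul m q_gt0).
  by rewrite /m cardE index_mem mem_enum.
have f_inj : {in point_columns G p :\: D &, injective f}.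
  move=> i j /agree[ip iE wi] /agree[jp jE wj] fij.
  have : w i = w j by rewrite wi wj.
  move/enum_val_inj/(congr1 val); rewrite /= iE jE => modE.
  have ij : index i (enum (point_columns G p)) = index j (enum (point_columns G p)).
    by rewrite (divn_eq (index i _) q) (divn_eq (index j _) q) modE -/(f i) fij.
  by rewrite -(nth_index i (s := enum (point_columns G p)) (x := i))
    ?mem_enum // ij nth_index ?mem_enum.
rewrite cardE -(size_map f) -[leqRHS](size_iota 0).
apply: uniq_leq_size => [|_ /mapP[j jp ->]].
  by rewrite map_inj_in_uniq ?enum_uniq // => i j; rewrite !mem_enum; apply: f_inj.
by rewrite mem_iota add0n; apply: f_lt; rewrite -mem_enum.
Qed.

(** Counting: multiplication by [G] maps the row vectors of length [k] onto [C], which has equally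
    many elements, so its kernel is trivial. *)
Lemma generator_matrix_row_free (F : finFieldType) (n k : nat)
    (C : {vspace 'rV[F]_n}) (G : 'M[F]_(k, n)) :
  \dim C = k -> generator_matrix C G -> row_free G.
Proof.
move=> dimC genG.
have imC : mulmxr G @: [set: 'rV[F]_k] = [set x in C].
  apply/setP => y; rewrite inE genG.
  by apply/imsetP/submxP => [[x _ ->]|[x ->]]; exists x.
have inj : {in [set: 'rV[F]_k] &, injective (mulmxr G)}.
  by apply/imset_injP; rewrite imC cardsE card_vspace dimC cardsT card_mx mul1n.
rewrite -kermx_eq0; apply/eqP/row_matrixP => i; rewrite row0.
by apply: inj; rewrite ?inE //= mul0mx -row_mul mulmx_ker row0.
Qed.

Lemma generator_matrix_change (F : finFieldType) (n k : nat)
    (C : {vspace 'rV[F]_n}) (G G' : 'M[F]_(k, n)) :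
  \dim C = k -> generator_matrix C G -> generator_matrix C G' ->
  exists2 A : 'M[F]_k, A \in unitmx & G' = A *m G.
Proof.
move=> dimC genG genG'.
have /submxP[A G'E] : (G' <= G)%MS.
  by apply/row_subP => i; rewrite -genG genG' row_sub.
have freeG' := generator_matrix_row_free dimC genG'.
exists A => //; rewrite -row_free_unit.
(* [A] has full rank because its product with [G] already has rank [k]. *)
rewrite /row_free eqn_leq rank_leq_row -{1}(eqP freeG') G'E.
exact: mxrankM_maxl.
Qed.

Lemma proj_point_mul (F : finFieldType) (k : nat) (A : 'M[F]_k) (v : 'cV[F]_k) :
  proj_point (A *m v) = mulmx A @: proj_point v.
Proof.
rewrite /proj_point -imset_comp; apply: eq_imset => a /=.
by rewrite scalemxAr.
Qed.

Lemma mulmx_unit_eq0 (F : finFieldType) (k m : nat) (A : 'M[F]_k)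
    (B : 'M[F]_(k, m)) : A \in unitmx -> (A *m B == 0) = (B == 0).
Proof.
move=> uA; apply/eqP/eqP => [AB|->]; last exact: mulmx0.
by rewrite -(mulKmx uA B) AB mulmx0.
Qed.

(** Stated for arbitrary sets of vectors, since the sum over [PG F k] is reindexed over that whole
    type. *)
Lemma imset_mulmx_inj (F : finFieldType) (k : nat) (A : 'M[F]_k) :
  A \in unitmx -> injective (fun p : {set 'cV[F]_k} => mulmx A @: p).
Proof. by move=> uA; apply/imset_inj/(can_inj (mulKmx uA)). Qed.

Lemma imset_mulmx_PG (F : finFieldType) (k : nat) (A : 'M[F]_k)
    (p : {set 'cV[F]_k}) : A \in unitmx ->
  (mulmx A @: p \in PG F k) = (p \in PG F k).
Proof.
move=> uA; apply/imsetP/imsetP => -[v]; rewrite inE => v0.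
  move=> pE; exists (invmx A *m v); first by rewrite inE mulmx_unit_eq0 ?unitmx_inv.
  apply: (imset_mulmx_inj uA); rewrite /= -proj_point_mul mulKVmx //.
by move=> ->; exists (A *m v); rewrite ?proj_point_mul // inE mulmx_unit_eq0.
Qed.

Lemma multiplicity_mul (F : finFieldType) (n k : nat) (A : 'M[F]_k)
    (G : 'M[F]_(k, n)) (p : {set 'cV[F]_k}) :
  A \in unitmx -> multiplicity (A *m G) (mulmx A @: p) = multiplicity G p.
Proof.
move=> uA; rewrite !multiplicityE; apply: eq_card => j; rewrite !inE.
rewrite col_mul mulmx_unit_eq0 // proj_point_mul.
by rewrite (inj_eq (imset_mulmx_inj uA)).
Qed.

Lemma lower_bound_mul (F : finFieldType) (n k t : nat) (A : 'M[F]_k)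
    (G : 'M[F]_(k, n)) :
  A \in unitmx -> lower_bound t (A *m G) = lower_bound t G.
Proof.
move=> uA; rewrite /lower_bound.
(* Moving [A] from the points to [U] is associativity: U(Av) = (UA)v. *)
rewrite [RHS](reindex (fun U : 'M[F]_(t, k) => U *m A)) /=; last first.
  by exists (mulmx^~ (invmx A)) => U _; rewrite ?mulmxK ?mulmxKV.
apply: eq_big => [U|U _]; first by rewrite mxrankMfree ?row_free_unit.
rewrite (reindex_inj (imset_mulmx_inj uA)) /=.
apply: eq_big => [p|p _]; last by rewrite multiplicity_mul.
rewrite imset_mulmx_PG //; case: imsetP => //= -[v _ ->].
by rewrite -proj_point_mul !nonvanishingE mulmxA.
Qed.

Theorem theorem17 (F : finFieldType) (n k t : nat) (C : {vspace 'rV[F]_n})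
    (dimC : \dim C = k) (t_range : (1 <= t <= k)%N)
    (G : 'M[F]_(k, n)) (genG : generator_matrix C G) :
  (lower_bound t G <= covering_radius t C)%N /\
  (forall G' : 'M[F]_(k, n), generator_matrix C G' ->
     lower_bound t G' = lower_bound t G).
Proof.
split=> [|G' genG'].
  apply/bigmax_leqP => U _.
  apply: leq_trans (covering_radius_ge_sum_PG t genG).
  by rewrite [leqRHS](bigID (nonvanishing U)) leq_addr.
have [A uA ->] := generator_matrix_change dimC genG genG'.
exact: lower_bound_mul.
Qed.
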